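(* Let $X$ be a complete doubling metric space and let $\{(\bar V_I,f_I)\}_{I\in\mathcal I^*}$ be a $(\{\lambda_i\}_{i=1}^k,\varphi,\nu)$-asymptotic similarity system in $X$. Then $\{\bar V_I\}_{I\in\mathcal I^*}$ is a controlled Moran construction; namely, there exists a constant $D\ge1$ such that for every $I,J\in\mathcal I^*$: (1) $\bar V_I\subset\bar V_{I^-}$; (2) there exists a positive integer $n$ such that $\max_{I\in\mathcal I^n}|\bar V_I|<D^{-1}$; (3) $D^{-1}\le\dfrac{|\bar V_{IJ}|}{|\bar V_I|\,|\bar V_J|}\le D$.
   Context: A metric space $X$ is doubling if there is a positive integer $C$ such that for every $x\in X$, $r>0$ the open ball $B(x,r)$ is covered by $C$ open balls of radius $r/2$. $|A|$ denotes the diameter of $A$ and bars denote closures. Standing assumption on $\varphi$: $0<\nu<1$ and $\varphi:(0,\infty)\to(0,\infty)$ is a continuous increasing function with $\lim_{x\to+0}\varphi(x)=0$ and $\int_1^\infty\varphi(a\nu^x)\,dx<\infty$ for some constant $a>0$. Almost similarity maps: for bounded open sets $U,V\subset X$ with $\bar V\subset\bar U$ (and $|U|>0$, so that $\varphi(|U|)$ is defined) and $0<\lambda<1$, a homeomorphism $f:\bar U\to\bar V$ is a $(\lambda,\varphi(|\bar U|),\nu)$-almost similarity map if $\left|\frac{d(f(x),f(y))}{d(x,y)}-\lambda\right|\le\lambda\varphi(|U|)$ for all $x\ne y\in\bar U$, and $|V|\le\nu|U|$. Multi-indices: $k$ is a positive integer, $\mathcal I=\{1,\dots,k\}$, $\mathcal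 I^n$ is the set of words $i_1\cdots i_n$ of length $n$, $\mathcal I^*=\bigcup_{n\ge1}\mathcal I^n$. For $I=i_1\cdots i_{m-1}i_m$, $I^-=i_1\cdots i_{m-1}$ (empty word if $m=1$); $IJ$ denotes concatenation. Asymptotic similarity system: given $0<\lambda_i<1$ ($i=1,\dots,k$) and a non-empty bounded open set $V\subset X$ (write $V_\emptyset=V$), a $(\{\lambda_i\}_{i=1}^k,\varphi,\nu)$-asymptotic similarity system is a family $\{(\bar V_I,f_I)\}_{I\in\mathcal I^*}$ such that for every $I=I'i_n$ with $I'\in\mathcal I^{n-1}$ (empty word if $n=1$), $i_n\in\mathcal I$, the set $V_I:=f_I(V_{I'})$ is open, $f_I:\bar V_{I'}\to\bar V_I\subset\bar V_{I'}$ is a $(\lambda_{i_n},\varphi(|\bar V_{I'}|),\nu)$-almost similarity map, and $V_{I'i}\cap V_{I'j}=\emptyset$ for all $i\ne j\in\mathcal I$. *)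

(* Defs.v *)
From HB Require Import structures.
From mathcomp Require Import all_boot all_order all_algebra.
From mathcomp Require Import all_classical all_reals all_analysis.

Set Implicit Arguments.
Unset Strict Implicit.
Unset Printing Implicit Defensive.

Import Order.TTheory GRing.Theory Num.Theory.
Import numFieldNormedType.Exports.

Local Open Scope classical_set_scope.
Local Open Scope ring_scope.

#[short(type="completeMetricType")]
HB.structure Definition CompleteMetric (K : numDomainType) :=
  {T of Metric K T & CompletePseudoMetric K T}.

Section metric_notions.
Context {R : realType} {X : metricType R}.
Implicit Types (A B U V : set X) (f : X -> X).

Definition doubling (T : metricType R) : Prop :=
  exists2 C : nat, (0 < C)%N &
    forall (x : T) (r : R), 0 < r ->
      exists c : 'I_C -> T, ball x r `<=` \bigcup_(i : 'I_C) ball (c i) (r / 2).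

Definition distances A : set R := [set mdist x y | x in A & y in A].

Definition metric_bounded A : Prop := has_ubound (distances A).

(* [sup] is the genuine supremum only when A is nonempty and bounded; it is 0
   when A is empty or unbounded. *)
Definition diam A : R := sup (distances A).

(* Only the restriction of the total function f to A is meaningful. *)
Definition homeomorphism_on A B f : Prop :=
  [/\ set_bij A B f,
      {within A, continuous f} &
      exists2 g : X -> X, {in A, cancel f g} & {within B, continuous g}].

Definition almost_similarity (lam : R) (phi : R -> R) (nu : R) U V f : Prop :=
  [/\ [/\ open U, open V, metric_bounded U & metric_bounded V],
      [/\ closure V `<=` closure U, 0 < diam U & 0 < lam < 1],
      homeomorphism_on (closure U) (closure V) f,
      forall x y, closure U x -> closure U y -> x != y ->
        `|mdist (f x) (f y) / mdist x y - lam| <= lam * phi (diam U) &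
      diam V <= nu * diam U].

End metric_notions.

(* phi is a total function of which only the values on ]0, +oo[ matter.  As
   phi is positive there, the Lebesgue integral is the improper integral. *)
Definition gauge {R : realType} (nu : R) (phi : R -> R) : Prop :=
  [/\ forall x : R, 0 < x -> 0 < phi x,
      {within `]0, +oo[, continuous phi},
      {in `]0, +oo[ &, {homo phi : x y / x <= y}},
      phi x @[x --> 0^'+] --> 0 &
      exists2 a : R, 0 < a &
        (\int[lebesgue_measure]_(x in `[1%R, +oo[) (phi (a * nu `^ x)%R)%:E
           < +oo)%E].

Section words.
Context {R : realType} {X : metricType R} {k : nat}.
Implicit Types (I J : seq 'I_k).

(* Finite words over the alphabet are sequences; the index set of a
   construction consists of the words different from [::]. *)
Definition parent I : seq 'I_k := take (size I).-1 I.

(* The initial open set is V [::]; the value f [::] is irrelevant. *)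
Definition asymptotic_similarity_system (lam : 'I_k -> R) (phi : R -> R)
    (nu : R) (V : seq 'I_k -> set X) (f : seq 'I_k -> X -> X) : Prop :=
  [/\ [/\ V [::] !=set0, metric_bounded (V [::]) & open (V [::])],
      forall I i, V (rcons I i) = f (rcons I i) @` V I,
      forall I i, almost_similarity (lam i) phi nu
                    (V I) (V (rcons I i)) (f (rcons I i)) &
      forall I i j, i != j -> V (rcons I i) `&` V (rcons I j) = set0].

(* Diameters are nonnegative, so the seed 0 does not affect the maximum. *)
Definition controlled_moran (A : seq 'I_k -> set X) : Prop :=
  exists2 D : R, 1 <= D &
    [/\ forall I, I != [::] -> A I `<=` A (parent I),
        exists2 n : nat, (0 < n)%N &
          \big[Num.max/0]_(I : n.-tuple 'I_k) diam (A I) < D^-1 &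
        forall I J, I != [::] -> J != [::] ->
          D^-1 <= diam (A (I ++ J)) / (diam (A I) * diam (A J)) <= D].

End words.

(* Main.v *)
Require Import Defs.
From mathcomp Require Import all_boot all_order all_algebra.
From mathcomp Require Import all_classical all_reals all_analysis.
From mathcomp Require Import measurable_realfun ring lra.

Set Implicit Arguments.
Unset Strict Implicit.
Unset Printing Implicit Defensive.

Import Order.TTheory GRing.Theory Num.Theory.
Import numFieldNormedType.Exports.

Local Open Scope classical_set_scope.
Local Open Scope ring_scope.

(** Why the theorem is true.  Write d W for the diameter of the open set V W
    (closing the set does not change it) and w W for the product of the ratios
    lam i over the letters of W.  A sequence of almost similarities multiplies
    diameters by the ratios, up to distortion: passing from W to [rcons W i]
    multiplies the quotient d W / w W by a factor between 1 - phi (d W) and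
    1 + phi (d W) ([almost_similarity_diam]).

    Diameters decay at least geometrically, d W <= d [::] * nu ^+ size W, so
    the errors phi (d W) are bounded by the sequence phi (d [::] * nu ^+ n),
    which depends only on the length n of W.  The integral condition on phi
    makes this sequence summable, by comparison of a monotone function with its
    integral ([gauge_geometric_tail]).  Hence the product of
    the distortion factors converges, and d W / w W stays between K^-1 and K
    for some K independent of W ([comparable_weight]).  The early steps, where
    1 - phi (d W) may fail to be positive, concern finitely many words only,
    and there positivity of the diameters suffices.

    Since w is multiplicative for concatenation, d is multiplicative up to the
    factor D = K ^+ 3, one K for each of the three diameters
    ([quasi_multiplicative]).  Finally d W tends to 0 uniformly in the length
    of W, so it falls below D^-1, and the nesting of the closures is part of
    the definition of an almost similarity. *)

(** * Diameters and maps that almost scale distances *)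

Section diameter.
Context {R : realType} {X : metricType R}.
Implicit Types (A : set X) (f : X -> X).

Lemma mdist_le_diam A x y : metric_bounded A -> A x -> A y ->
  mdist x y <= diam A.
Proof.
by move=> bA Ax Ay; apply: ub_le_sup => //; exists x => //; exists y.
Qed.

Lemma diam_le A (c : R) : A !=set0 ->
  (forall x y, A x -> A y -> mdist x y <= c) -> diam A <= c.
Proof.
move=> [a Aa] Ac; apply: ge_sup.
  by exists (mdist a a); exists a => //; exists a.
by move=> _ [x Ax [y Ay <-]]; exact: Ac.
Qed.

(** By convention the empty set has diameter 0. *)
Lemma diam_gt0_nonempty A : 0 < diam A -> A !=set0.
Proof.
move=> A0; apply/set0P/eqP => A_eq0; move: A0.
suff -> : diam A = 0 by rewrite ltxx.
rewrite /diam (_ : distances A = set0) ?sup0 // A_eq0.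
by apply/seteqP; split => // _ [x []].
Qed.

(** Points of the closure are limits of points of A, so the distances between
    them are limits of distances in A. *)
Lemma mdist_closure_le_diam A x y : metric_bounded A ->
  closure A x -> closure A y -> mdist x y <= diam A.
Proof.
move=> bA Ax Ay; apply/ler_addgt0Pr => e e0.
have e20 : 0 < e / 2 by rewrite divr_gt0.
have [x' [Ax']] := Ax _ (nbhsx_ballx x _ e20).
have [y' [Ay']] := Ay _ (nbhsx_ballx y _ e20).
rewrite !ballEmdist /= => yy' xx'.
have := mdist_le_diam bA Ax' Ay'.
have := metric_triangle x x' y; have := metric_triangle x' y' y.
rewrite (metric_sym y' y); lra.
Qed.

Lemma diam_closure A : metric_bounded A -> A !=set0 ->
  diam (closure A) = diam A.
Proof.
move=> bA A0; have cA0 : closure A !=set0.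
  by have [a Aa] := A0; exists a; exact: subset_closure.
apply/le_anti/andP; split.
  by apply: diam_le => // x y; exact: mdist_closure_le_diam.
apply: diam_le => // x y Ax Ay; apply: mdist_le_diam; last 2 first.
- exact: subset_closure.
- exact: subset_closure.
by exists (diam A) => _ [u Au [v Av <-]]; exact: mdist_closure_le_diam.
Qed.

Lemma diam_image_le A f (L : R) : 0 <= L -> metric_bounded A -> A !=set0 ->
  (forall x y, A x -> A y -> mdist (f x) (f y) <= L * mdist x y) ->
  diam (f @` A) <= L * diam A.
Proof.
move=> L0 bA [a Aa] fL; apply: diam_le; first by exists (f a); exists a.
move=> _ _ [x Ax <-] [y Ay <-]; apply: (le_trans (fL _ _ Ax Ay)).
by apply: ler_wpM2l => //; exact: mdist_le_diam.
Qed.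

Lemma diam_image_ge A f (l : R) : 0 < l -> metric_bounded (f @` A) ->
  A !=set0 ->
  (forall x y, A x -> A y -> l * mdist x y <= mdist (f x) (f y)) ->
  l * diam A <= diam (f @` A).
Proof.
move=> l0 bfA A0 fl; rewrite mulrC -ler_pdivlMr //.
apply: diam_le => // x y Ax Ay.
rewrite ler_pdivlMr // mulrC; apply: (le_trans (fl _ _ Ax Ay)).
by apply: mdist_le_diam => //; exact: imageP.
Qed.

(** The distortion bound on quotients of distances passes to the supremum.  The
    lower bound is informative only when the contraction is by a positive
    factor. *)
Lemma almost_similarity_diam (lam : R) phi nu A f :
  almost_similarity lam phi nu A (f @` A) f -> 0 <= phi (diam A) ->
  diam (f @` A) <= lam * (1 + phi (diam A)) * diam A /\
  (phi (diam A) < 1 -> lam * (1 - phi (diam A)) * diam A <= diam (f @` A)).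
Proof.
move=> [[_ _ bA bfA] [_ A0 /andP[lam0 _]] _ fE _] p_ge0.
have {}A0 := diam_gt0_nonempty A0; set p := phi _ in fE p_ge0 *.
have fE' x y : A x -> A y -> lam * (1 - p) * mdist x y <= mdist (f x) (f y) <=
    lam * (1 + p) * mdist x y.
  move=> Ax Ay; have [->|xy] := eqVneq x y.
    by rewrite !mdistxx !mulr0 lexx.
  have := fE x y (subset_closure Ax) (subset_closure Ay) xy.
  rewrite -mdist_gt0 in xy; rewrite ler_distl => /andP[].
  rewrite ler_pdivlMr // ler_pdivrMr // => h1 h2.
  apply/andP; split; lra.
split.
  apply: diam_image_le => // [|x y Ax Ay]; last first.
    by have /andP[] := fE' _ _ Ax Ay.
  by rewrite mulr_ge0 ?addr_ge0 // ltW.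
move=> p1; apply: diam_image_ge => // [|x y Ax Ay]; last first.
  by have /andP[] := fE' _ _ Ax Ay.
by rewrite mulr_gt0 // subr_gt0.
Qed.

End diameter.

(** * Summability of the gauge along a geometric progression *)

(** On the j-th unit interval a nonincreasing function is at least its value at
    the right endpoint. *)
Lemma sum_le_integral {R : realType} (g : R -> R) (a : R) (n : nat) :
  nonincreasing_fun g -> (forall x, 0 <= g x) ->
  ((\sum_(j < n) g (a + j.+1%:R))%:E
     <= \int[lebesgue_measure]_(x in `[a, (a + n%:R)%R[) (g x)%:E)%E.
Proof.
move=> g_ni g0; elim: n => [|n IHn].
  by rewrite big_ord0; apply: integral_ge0 => x _; rewrite lee_fin.
have mg (D : set R) : measurable D -> measurable_fun D (fun x => (g x)%:E).
  by move=> mD; apply/measurable_EFinP; exact: nonincreasing_measurable.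
have an : a + n%:R <= a + n.+1%:R by rewrite lerD2l ler_nat.
rewrite (_ : `[a, (a + n.+1%:R)[%classic =
    `[a, (a + n%:R)[%classic `|` `[(a + n%:R), (a + n.+1%:R)[%classic);
  last first.
  by rewrite -itv_bndbnd_setU // bnd_simp // lerDl.
rewrite ge0_integral_setU //=; last 3 first.
- by apply: mg; exact: measurableU.
- by move=> x _; rewrite lee_fin.
- by apply: lt_disjoint => x y; rewrite !in_itv/= => /andP[_ xn] /andP[ny _];
    exact: lt_le_trans ny.
rewrite big_ord_recr /= EFinD; apply: leeD => //.
have -> : (g (a + n.+1%:R))%:E =
    (\int[lebesgue_measure]_(x in `[(a + n%:R)%R, (a + n.+1%:R)%R[)
      (cst (g (a + n.+1%:R))%:E x))%E.
  rewrite integral_cst //= lebesgue_measure_itv /= lte_fin ltrD2l ltr_nat ltnSn.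
  by rewrite -EFinB opprD addrACA subrr add0r -natrB // subSnn mule1.
apply: ge0_le_integral => //=.
- by move=> x _; rewrite lee_fin.
- exact: mg.
by move=> x; rewrite in_itv/= lee_fin => /andP[_ /ltW]; exact: g_ni.
Qed.

Lemma sum_le_integral_ray {R : realType} (g : R -> R) (a : R) :
  nonincreasing_fun g -> (forall x, 0 <= g x) ->
  (\int[lebesgue_measure]_(x in `[a, +oo[) (g x)%:E < +oo)%E ->
  exists M, forall n, \sum_(j < n) g (a + j.+1%:R) <= M.
Proof.
move=> g_ni g0 goo.
exists (fine (\int[lebesgue_measure]_(x in `[a, +oo[) (g x)%:E)) => n.
rewrite -lee_fin fineK; last first.
  by rewrite ge0_fin_numE // integral_ge0 // => x _; rewrite lee_fin.
apply: (le_trans (sum_le_integral a n g_ni g0)).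
apply: ge0_subset_integral => //=.
- by apply/measurable_EFinP; exact: nonincreasing_measurable.
- by move=> x _; rewrite lee_fin.
by move=> x /=; rewrite !in_itv/= => /andP[->].
Qed.

Lemma gauge_le {R : realType} (nu : R) phi (x y : R) :
  gauge nu phi -> 0 < x -> x <= y -> phi x <= phi y.
Proof.
move=> [_ _ phi_nd _ _] x0 xy; apply: phi_nd => //; rewrite in_itv/= andbT //.
exact: lt_le_trans xy.
Qed.

(** The integral condition concerns the progression issued from some a; any
    other starting point r is reached from a by discarding finitely many terms,
    as phi is monotone and nu < 1.  The bound 1 / 2 is what keeps the factors
    1 - phi away from 0. *)
Lemma gauge_geometric_tail {R : realType} (nu : R) phi (r : R) :
  0 < nu < 1 -> gauge nu phi -> 0 < r ->
  exists N, phi (r * nu ^+ N) <= 1 / 2 /\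
    exists M, forall n, \sum_(j < n) phi (r * nu ^+ (N + j)) <= M.
Proof.
move=> /andP[nu0 nu1] gphi r0.
have [phi0 _ _ phi_cvg [a a0 phi_int]] := gphi.
have phi_le (x y : R) := @gauge_le R nu phi x y gphi.
have [d d0 phid] : exists2 d : R, 0 < d & phi d <= 1 / 2.
  near (0 : R)^'+ => x; exists x; first by near: x; exact: nbhs_right_gt.
  by near: x; apply: (cvgr_le 0) => //; rewrite divr_gt0.
(* The integral starts at 1 and dominates the values at 2, 3, ...: this is why
   r * nu ^+ N is brought below a * nu ^+ 2. *)
pose e := Num.min d (a * nu ^+ 2).
have e0 : 0 < e by rewrite lt_min d0 mulr_gt0 // exprn_gt0.
have [N rN] : exists N, r * nu ^+ N <= e.
  have : \forall n \near \oo, nu ^+ n <= e / r.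
    apply: (cvgr_le 0); last by rewrite divr_gt0.
    by apply: cvg_expr; rewrite ger0_norm // ltW.
  move=> [N _ /(_ N (leqnn N))] /=; rewrite ler_pdivlMr // mulrC => h.
  by exists N.
move: rN; rewrite le_min => /andP[rNd rNa].
have rnu n : 0 < r * nu ^+ n by rewrite mulr_gt0 // exprn_gt0.
exists N; split; first exact: le_trans (phi_le _ _ (rnu N) rNd) phid.
pose g x := phi (a * nu `^ x).
have [x y xy|x|//|M gM] := @sum_le_integral_ray R g 1.
- apply: phi_le; first by rewrite mulr_gt0 // powR_gt0.
  by rewrite ler_pM2l // ger_powR // nu0 ltW.
- by rewrite ltW // phi0 // mulr_gt0 // powR_gt0.
exists M => n; apply: le_trans (gM n); apply: ler_sum => j _.
apply: phi_le => //; rewrite nat1r powR_mulrn ?(ltW nu0) //.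
rewrite -add2n !exprD [leRHS]mulrA [leLHS]mulrA.
by rewrite ler_pM2r ?exprn_gt0.
Unshelve. all: by end_near. Qed.

(** * Functions of words that are almost multiplicative *)

(** The sum of all the values and of their inverses serves as c. *)
Lemma finite_pos_bounded {R : realType} (S : finType) (h : S -> R) :
  (forall s, 0 < h s) ->
  exists2 c : R, 0 < c & forall s, c^-1 <= h s <= c.
Proof.
move=> h0; pose t s := h s + (h s)^-1.
have t0 s : 0 < t s by rewrite addr_gt0 // invr_gt0.
have c0 : 0 < 1 + \sum_s t s.
  by rewrite ltr_pwDl // sumr_ge0 // => s _; exact: ltW.
exists (1 + \sum_s t s) => // s.
have tc : t s <= 1 + \sum_s t s.
  rewrite (bigD1 s) //= addrCA lerDl addr_ge0 // sumr_ge0 // => u _; exact: ltW.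
have hs : 0 < (h s)^-1 by rewrite invr_gt0.
apply/andP; split; last by apply: le_trans tc; rewrite lerDl ltW.
by rewrite -[leRHS]invrK lef_pV2 ?posrE //; apply: le_trans tc;
  rewrite lerDr ltW.
Qed.

Definition weight {R : realType} {T : Type} (lam : T -> R) (W : seq T) : R :=
  \prod_(i <- W) lam i.

Lemma weight_gt0 {R : realType} {T : Type} (lam : T -> R) (W : seq T) :
  (forall i, 0 < lam i) -> 0 < weight lam W.
Proof. by move=> lam0; apply: prodr_gt0 => i _; exact: lam0. Qed.

(** Multiplying the quotient d W / weight lam W by the successive distortion
    factors starting from length N costs at most [expR (2 * M)], as
    1 + p <= expR (2 * p) and, for p <= 1 / 2, also 1 - p >= expR (- (2 * p)).
    The words of length at most N form a finite type, which is where finiteness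
    of the alphabet enters. *)
Lemma comparable_weight {R : realType} {T : finType} (d : seq T -> R)
    (lam : T -> R) (p : nat -> R) (N : nat) (M : R) :
  (forall W, 0 < d W) -> (forall i, 0 < lam i) ->
  (forall W i, (N <= size W)%N ->
    lam i * (1 - p (size W)) * d W <= d (rcons W i)
      <= lam i * (1 + p (size W)) * d W) ->
  (forall n, (N <= n)%N -> 0 <= p n <= 1 / 2) ->
  (forall n, \sum_(j < n) p (N + j)%N <= M) ->
  exists2 K : R, 0 < K & forall W, K^-1 <= d W / weight lam W <= K.
Proof.
move=> d0 lam0 dS p12 pM; pose q W := d W / weight lam W.
have w0 W : 0 < weight lam W by exact: weight_gt0.
have q0 W : 0 < q W by rewrite divr_gt0.
have [c c0 qc] : exists2 c : R, 0 < c &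
    forall W : N.-bseq T, c^-1 <= q W <= c by exact: finite_pos_bounded.
have M0 : 0 <= M by have := pM 0; rewrite big_ord0.
have qS W i : (N <= size W)%N ->
    expR (- (2 * p (size W))) * q W <= q (rcons W i)
      <= expR (2 * p (size W)) * q W.
  move=> NW; have /andP[dl du] := dS W i NW; have /andP[p0 p2] := p12 _ NW.
  have qE : q (rcons W i) = d (rcons W i) / (lam i * weight lam W).
    by rewrite /q /weight -cats1 big_cat big_seq1 /= [lam i * _]mulrC.
  have lw : 0 < lam i * weight lam W by rewrite mulr_gt0.
  set P := p _ in dl du p0 p2 *.
  have E z : z * q W * (lam i * weight lam W) = lam i * z * d W.
    by rewrite /q; have := w0 W => /gt_eqF/negbT w; field.
  rewrite qE ler_pdivlMr // ler_pdivrMr // !E.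
  apply/andP; split.
    (* (1 - p)^-1 <= 1 + 2 * p for 0 <= p <= 1 / 2, and 1 + x <= expR x. *)
    apply: le_trans dl; rewrite ler_pM2r // ler_pM2l //.
    rewrite expRN -[leRHS]invrK lef_pV2 ?posrE ?expR_gt0 ?invr_gt0 //; last lra.
    apply: le_trans (expR_ge1Dx _).
    rewrite -div1r ler_pdivrMr; [nra|lra].
  apply: (le_trans du); rewrite ler_pM2r // ler_pM2l //.
  by apply: le_trans (expR_ge1Dx _); lra.
have qtail W U : size W = N -> let s := \sum_(j < size U) p (N + j)%N in
    expR (- (2 * s)) * q W <= q (W ++ U) <= expR (2 * s) * q W.
  move=> WN; elim/last_ind: U => [|U i IHU] /=.
    by rewrite big_ord0 mulr0 oppr0 expR0 cats0 !mul1r lexx.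
  rewrite -rcons_cat size_rcons big_ord_recr /=.
  have := qS (W ++ U) i; rewrite size_cat WN leq_addr => /(_ isT) /andP[ql qu].
  move/andP: IHU => [Il Iu]; rewrite mulrDr opprD !expRD; apply/andP; split.
    by apply: le_trans ql; rewrite [X in X * _]mulrC -mulrA ler_pM2l ?expR_gt0.
  apply: (le_trans qu).
  by rewrite [X in _ <= X * _]mulrC -mulrA ler_pM2l ?expR_gt0.
have E0 : 1 <= expR (2 * M) by rewrite -expR0 ler_expR mulr_ge0.
exists (expR (2 * M) * c); first by rewrite mulr_gt0 ?expR_gt0.
have eM (s : R) : s <= M -> expR (2 * s) <= expR (2 * M) /\
    (expR (2 * M))^-1 <= expR (- (2 * s)).
  by move=> sM; rewrite -expRN !ler_expR lerN2 ler_pM2l.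
move=> W; rewrite -/(q W) invfM.
have [WN|NW] := leqP (size W) N.
  have /andP[ql qu] := qc (Bseq WN).
  rewrite /= in ql qu; apply/andP; split.
    apply: le_trans ql; rewrite ler_piMl ?invr_ge0 ?(ltW c0) //.
    by rewrite invf_le1 ?expR_gt0.
  by apply: (le_trans qu); rewrite ler_peMl // ltW.
have szW : size (take N W) = N by rewrite size_takel // ltnW.
have WN : (size (take N W) <= N)%N by rewrite szW.
have /andP[ql qu] := qc (Bseq WN).
have := qtail (take N W) (drop N W) szW.
rewrite cat_take_drop => /= /andP[tl tu].
have [eu el] := eM _ (pM (size (drop N W))); apply/andP; split.
  apply: le_trans tl; apply: ler_pM => //; rewrite invr_ge0 ?expR_ge0 // ltW //.
by apply: (le_trans tu); apply: ler_pM; rewrite ?expR_ge0 // ltW.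
Qed.

(** The weights cancel exactly, leaving three bounded quotients. *)
Lemma quasi_multiplicative {R : realType} {T : Type} (d : seq T -> R)
    (lam : T -> R) (K : R) :
  (forall i, 0 < lam i) -> 0 < K ->
  (forall W, 0 < d W) ->
  (forall W, K^-1 <= d W / weight lam W <= K) ->
  forall I J, (K ^+ 3)^-1 <= d (I ++ J) / (d I * d J) <= K ^+ 3.
Proof.
move=> lam0 K0 d0 dK I J; pose q W := d W / weight lam W.
have w0 W : 0 < weight lam W by exact: weight_gt0.
have q0 W : 0 < q W by rewrite divr_gt0.
have -> : d (I ++ J) / (d I * d J) = q (I ++ J) * ((q I)^-1 * (q J)^-1).
  have -> : q (I ++ J) = d (I ++ J) / (weight lam I * weight lam J).
    by rewrite /q /weight big_cat.
  rewrite /q.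
  have := w0 I; have := w0 J; have := d0 I; have := d0 J.
  move=> /gt_eqF/negbT ? /gt_eqF/negbT ? /gt_eqF/negbT ? /gt_eqF/negbT ?.
  by field; do !(apply/andP; split).
have K'0 : 0 < K^-1 by rewrite invr_gt0.
have qV W : K^-1 <= (q W)^-1 <= K.
  have /andP[h1 h2] := dK W.
  by rewrite lef_pV2 ?posrE // h2 -[leRHS]invrK lef_pV2 ?posrE.
have /andP[lI uI] := qV I; have /andP[lJ uJ] := qV J.
have /andP[lIJ uIJ] := dK (I ++ J); rewrite -exprVn !exprS expr0 !mulr1.
have K'_ge0 := ltW K'0; have qV0 W : 0 <= (q W)^-1 by rewrite invr_ge0 ltW.
apply/andP; split.
  by apply: ler_pM => //; [exact: mulr_ge0|exact: ler_pM].
by apply: ler_pM => //; [exact: ltW|exact: mulr_ge0|exact: ler_pM].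
Qed.

(** * Asymptotic similarity systems *)

Section asymptotic.
Context {R : realType} {X : metricType R} {k : nat}.
Context (lam : 'I_k -> R) (phi : R -> R) (nu : R).
Context (V : seq 'I_k -> set X) (f : seq 'I_k -> X -> X).
Context (k0 : (0 < k)%N) (nu01 : 0 < nu < 1).
Context (sys : asymptotic_similarity_system lam phi nu V f).

(** Each V W is the domain of the map of one of its children, hence the need
    for a letter. *)
Lemma system_diam_gt0 W : 0 < diam (V W).
Proof. by have [_ _ /(_ W (Ordinal k0))[_ []]] := sys. Qed.

Lemma system_bounded W : metric_bounded (V W).
Proof. by have [_ _ /(_ W (Ordinal k0))[[]]] := sys. Qed.

Lemma system_diam_closure W : diam (closure (V W)) = diam (V W).
Proof.
apply: diam_closure; first exact: system_bounded.
exact/diam_gt0_nonempty/system_diam_gt0.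
Qed.

Lemma system_diam_le W : diam (V W) <= diam (V [::]) * nu ^+ size W.
Proof.
have [_ _ sim _] := sys; have /andP[nu0 _] := nu01.
elim/last_ind: W => [|W i IHW]; first by rewrite mulr1.
have [_ _ _ _ h] := sim W i; apply: (le_trans h).
by rewrite size_rcons exprS mulrCA ler_pM2l.
Qed.

End asymptotic.

Theorem lemma3p12 (R : realType) (X : completeMetricType R) (k : nat)
  (lam : 'I_k -> R) (phi : R -> R) (nu : R)
  (V : seq 'I_k -> set X) (f : seq 'I_k -> X -> X) :
  doubling X ->
  (0 < k)%N ->
  0 < nu < 1 ->
  gauge nu phi ->
  (forall i, 0 < lam i < 1) ->
  asymptotic_similarity_system lam phi nu V f ->
  controlled_moran (fun I => closure (V I)).
Proof.
move=> _ k0 nu01 gphi lam01 sys.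
have /andP[nu0 nu1] := nu01.
have lam0 i : 0 < lam i by have /andP[] := lam01 i.
pose d W := diam (V W).
have d0 W : 0 < d W by exact: system_diam_gt0 sys W.
have dE W : diam (closure (V W)) = d W by exact: system_diam_closure sys W.
have dle W : d W <= d [::] * nu ^+ size W by exact: system_diam_le sys W.
have [phi0 _ _ _ _] := gphi.
have phi_le (x y : R) := @gauge_le R nu phi x y gphi.
have [N [phiN [M phiM]]] := gauge_geometric_tail nu01 gphi (d0 [::]).
pose p n := phi (d [::] * nu ^+ n).
have r0 n : 0 < d [::] * nu ^+ n by rewrite mulr_gt0 ?exprn_gt0.
have p12 n : (N <= n)%N -> 0 <= p n <= 1 / 2.
  move=> Nn; rewrite ltW ?phi0 //=; apply: le_trans phiN; apply: phi_le => //.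
  by rewrite ler_pM2l // ler_wiXn2l // ltW.
have dS W i : (N <= size W)%N -> lam i * (1 - p (size W)) * d W <= d (rcons W i)
    <= lam i * (1 + p (size W)) * d W.
  move=> NW; have [_ VE sim _] := sys; have := sim W i; rewrite VE.
  move=> /almost_similarity_diam; rewrite -VE -/(d _) -/(d _).
  move=> /(_ (ltW (phi0 _ (d0 W))))[du dl].
  have pW : phi (d W) <= p (size W) by exact: phi_le.
  have /andP[_ p2] := p12 _ NW.
  apply/andP; split.
    apply: le_trans (dl _); last lra.
    by rewrite ler_pM2r // ler_pM2l // lerD2l lerN2.
  by apply: (le_trans du); rewrite ler_pM2r // ler_pM2l // lerD2l.
have [K K0 dK] := comparable_weight d0 lam0 dS p12 phiM.
have qm := quasi_multiplicative lam0 K0 d0 dK.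
have K3 : 0 < K ^+ 3 by rewrite exprn_gt0.
have K1 : 1 <= K ^+ 3.
  have /andP[h1 h2] := qm [::] [::].
  (* From D^-1 <= D. *)
  have := le_trans h1 h2; rewrite -div1r ler_pdivrMr // -expr2 expr_ge1 //.
  exact: ltW.
exists (K ^+ 3) => //; split.
- elim/last_ind => // I i _ _; rewrite /parent size_rcons /= -cats1.
  rewrite take_size_cat //.
  by have [_ _ /(_ I i)[_ []]] := sys; rewrite cats1.
- have : \forall n \near \oo, nu ^+ n < (K ^+ 3)^-1 / d [::].
    apply: (cvgr_lt 0); last by rewrite !divr_gt0 ?invr_gt0.
    by apply: cvg_expr; rewrite ger0_norm // ltW.
  move=> [n _ /(_ n.+1 (leqnSn n))] /=; rewrite ltr_pdivlMr // mulrC => h.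
  exists n.+1 => //; apply: bigmax_lt; first by rewrite invr_gt0.
  move=> I _; rewrite dE; apply: le_lt_trans h.
  by rewrite -{2}(size_tuple I); exact: dle.
- by move=> I J _ _; rewrite !dE; exact: qm.
Qed.
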